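(* Let $(w(i);i\ge1)$ be any sequence of nonnegative real numbers, and set $w(0)=1$. Then, for every $n\ge1$ such that $\sum_{Q\in\mathbb{NC}_n}\Omega^w(Q)>0$ and every $P\in\mathbb{NC}_n$, $$\mathbb{P}^w_n(P)=\mathbb{Q}^w_{n+1}(\mathcal{T}^\circ(P)).$$
   Context: Non-crossing partitions. A partition of $[n]=\{1,\dots,n\}$ is non-crossing if, when $1,\dots,n$ are placed in clockwise order at the vertices of a regular $n$-gon, the convex hulls of its blocks are pairwise disjoint; $\mathbb{NC}_n$ is the set of non-crossing partitions of $[n]$. For $P\in\mathbb{NC}_n$, $\Omega^w(P)=\prod_{B\text{ block of }P}w(|B|)$ and $\mathbb{P}^w_n(P)=\Omega^w(P)/\sum_{Q\in\mathbb{NC}_n}\Omega^w(Q)$. Plane trees. Plane trees are finite rooted trees with ordered children (as finite subsets of $\bigcup_{m\ge0}\mathbb{N}^m$, with root $\varnothing$, children of $u$ denoted $u1,\dots,uk_u$, where $k_u$ is the outdegree; $pr(u)$ is the parent of $u$); $\mathbb{T}_m$ is the set of plane trees with $m$ vertices. For $\tau\in\mathbb{T}_m$, $\Omega^w(\tau)=\prod_{u\in\tau}w(k_u)$ and $\mathbb{Q}^w_m(\tau)=\Omega^w(\tau)/\sum_{T\in\mathbb{T}_m}\Omega^w(T)$ (when the denominator is positive). Dual tree. Draw $P$ with $l\in[n]$ at $e^{-2\mathrm{i}\pi l/n}$ and each block as its polygon (singletons being viewed as self-loops and blocks of size two as double edges). Put a black vertex inside each block and a white vertex inside each other face of the disk,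 and join two vertices if the corresponding faces share a common edge (equivalently: for each $l\in[n]$ there is one edge joining the block containing $l$ to the white face whose boundary contains the arc of circle going clockwise from $l$ to $l+1$, where $n+1$ means $1$). This gives a planar bipartite tree $T(P)$ with $n+1$ vertices. $T^\circ(P)$ is the plane tree obtained by rooting $T(P)$ at the white vertex of the face containing the vertices $1$ and $n$ (the face adjacent to the arc from $n$ to $1$), so that its first child is the block containing $1$; children are listed in clockwise order (starting from the root corner for the root, from the edge to the parent for other vertices). Janson–Stefánsson bijection $\mathcal{G}$. For a plane tree $T$, $\mathcal{G}(T)$ is a plane tree on the same vertices. If $T=\{\varnothing\}$, $\mathcal{G}(T)=\{\varnothing\}$. Otherwise, for every vertex $u$ at even generation of $T$ with $k_u\ge1$ children: if $u\ne\varnothing$, draw an edge between $pr(u)$ and $u1$; draw edges between consecutive children $u1$–$u2$, …, $u(k_u-1)$–$uk_u$; draw an edge between $uk_u$ and $u$. If $u$ is a leaf at even generation, draw an edge between $u$ and $pr(u)$. The root of $\mathcal{G}(T)$ is the first child of the root of $T$. Explicitly: vertices at even generation of $T$ become leaves, and a vertex $v$ at odd generation with $k$ children $v1,\dots,vk$ has $k+1$ ordered children in $\mathcal{G}(T)$: $c(v1),\dots,c(vk)$, followed by the next sibling of $v$ in $T$ if there is one and by $pr(v)$ otherwise, where $c(vi)$ is the first child of $vi$ in $T$ if $vi$ has children and $c(vi)=vi$ otherwise. Set $\mathcal{T}^\circ(P)=\mathcal{G}(T^\circ(P))$, a plane tree with $n+1$ vertices. *)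

(* Defs.v *)
From HB Require Import structures.
From mathcomp Require Import all_boot all_order all_algebra.
From mathcomp Require Import all_classical all_reals all_analysis.

Set Implicit Arguments.
Unset Strict Implicit.
Unset Printing Implicit Defensive.

Import Order.TTheory GRing.Theory Num.Theory.
Import numFieldNormedType.Exports.

Local Open Scope classical_set_scope.
Local Open Scope ring_scope.

Section NonCrossing.
Variable R : realType.

Definition plane := (R^o * R^o)%type.

Definition convex_hull (S : set plane) : set plane := smallest (@convex_set R plane) S.

Definition unit_disk : set plane := [set z | z.1 ^+ 2 + z.2 ^+ 2 <= 1].

(* exp(-2 i pi x / n): increasing x is clockwise. *)
Definition circle_point (n : nat) (x : R) : plane :=
  (cos (- (2 * pi * x / n%:R)), sin (- (2 * pi * x / n%:R))).

(* The ordinal i : 'I_n stands for the element i.+1 of [n] = {1, ..., n}. *)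
Definition label n (i : 'I_n) : nat := i.+1.

Definition block_hull n (B : {set 'I_n}) : set plane :=
  convex_hull [set circle_point n (label i)%:R | i in [set` B]].

Definition noncrossing n (P : {set {set 'I_n}}) : Prop :=
  forall B C : {set 'I_n}, B \in P -> C \in P -> B != C ->
    block_hull B `&` block_hull C = set0.

Definition NC (n : nat) : {set {set {set 'I_n}}} :=
  [set P | finset.partition P [set: 'I_n] && `[< noncrossing P >]]%SET.

Definition block_weight (w : nat -> R) n (P : {set {set 'I_n}}) : R :=
  \prod_(B in P) w #|B|.

Definition NC_prob (w : nat -> R) n (P : {set {set 'I_n}}) : R :=
  block_weight w P / \sum_(Q in NC n) block_weight w Q.

End NonCrossing.

Inductive plane_tree : Type := Node of seq plane_tree.

HB.instance Definition _ := gen_eqMixin plane_tree.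
HB.instance Definition _ := gen_choiceMixin plane_tree.

Definition children (t : plane_tree) : seq plane_tree := let: Node s := t in s.

(* A vertex is the word of the positions, counted from 0, followed on the way
   down from the root [::]; the children of u are rcons u 0, rcons u 1, ... *)
Fixpoint vertices (t : plane_tree) : seq (seq nat) :=
  let: Node s := t in
  let fix forest i s := if s is t' :: s'
    then [seq i :: u | u <- vertices t'] ++ forest i.+1 s' else [::] in
  [::] :: forest 0%N s.

Definition subtree (t : plane_tree) (u : seq nat) : plane_tree :=
  foldl (fun t' i => nth (Node [::]) (children t') i) t u.

Definition outdeg (t : plane_tree) (u : seq nat) : nat :=
  size (children (subtree t u)).

Definition trees (m : nat) : set plane_tree :=
  [set t | size (vertices t) = m].

Section TreeWeights.
Variable R : realType.

Definition tree_weight (w : nat -> R) (t : plane_tree) : R :=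
  \prod_(u <- vertices t) w (outdeg t u).

(* trees m is finite, so the finitely supported sum is the sum over trees m. *)
Definition tree_partition_function (w : nat -> R) (m : nat) : R :=
  \sum_(t \in trees m) tree_weight w t.

Definition tree_prob (w : nat -> R) (m : nat) (t : plane_tree) : R :=
  tree_weight w t / tree_partition_function w m.

End TreeWeights.

(* The plane tree rooted at r in which the children of v are ch v, in order,
   cut at height d; below, d always exceeds the height of the whole tree. *)
Fixpoint explore (V : Type) (ch : V -> seq V) (d : nat) (r : V) : plane_tree :=
  Node (if d is d'.+1 then [seq explore ch d' v | v <- ch r] else [::]).

Section DualTree.
Variables (R : realType) (n : nat) (P : {set {set 'I_n}}).

(* For l in [n], the face of the disk, outside the blocks, that is bounded by
   the open arc going clockwise from l to l+1; the arc is represented by its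
   midpoint.  The complement of the blocks is taken in the closed disk, so that
   each such face contains the open arcs that bound it. *)
Definition white_face (l : nat) : set (plane R) :=
  connected_component
    (@unit_disk R `\` \bigcup_(B in [set` P]) block_hull B)
    (circle_point n (l%:R + 2^-1)).

(* Vertices of T(P): inl is a black vertex (a block), inr a white one. *)
Definition dual_vertex : Type := ({set 'I_n} + set (plane R))%type.

(* The edges of T(P) are indexed by l in [n]: edge l joins the block of l to
   the white face of the arc from l to l+1.  Since labels increase clockwise
   along the circle, the increasing order of the labels is, up to rotation, the
   clockwise order of the edges around a vertex of either colour. *)
Definition dual_edges (v : dual_vertex) : seq 'I_n :=
  match v with
  | inl B => [seq l <- enum 'I_n | l \in B]
  | inr F => [seq l <- enum 'I_n | `[< white_face (label l) = F >]]
  end.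

Definition dual_neighbour (v : dual_vertex) (l : 'I_n) : dual_vertex :=
  match v with
  | inl _ => inr (white_face (label l))
  | inr _ => inl (finset.pblock P l)
  end.

(* A vertex is explored together with the edge to its parent (None at the
   root).  A non-root vertex lists its other edges clockwise from that one; the
   root lists all of its edges clockwise from the one leading to the block
   of 1. *)
Definition dual_children (x : dual_vertex * option 'I_n) :
    seq (dual_vertex * option 'I_n) :=
  let: (v, e) := x in
  let s := dual_edges v in
  let next := match e with
    | Some l => behead (rot (index l s) s)
    | None => rot (find (fun l => [exists i in finset.pblock P l, label i == 1%N]) s) s
    end in
  [seq (dual_neighbour v l, Some l) | l <- next].

(* white_face n is the face of the arc from n to n+1 = 1. *)
Definition dual_tree : plane_tree :=
  explore dual_children n.+1 (inr (white_face n), None).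

End DualTree.

Section JansonStefansson.
Variable T : plane_tree.

Definition first_child_or_self (u : seq nat) : seq nat :=
  if outdeg T u == 0%N then u else rcons u 0%N.

Definition parent (u : seq nat) : seq nat := take (size u).-1 u.

Definition next_sibling_or_parent (u : seq nat) : seq nat :=
  let: (p, j) := (parent u, last 0%N u) in
  if (j.+1 < outdeg T p)%N then rcons p j.+1 else p.

(* The generation of the vertex u of T is size u. *)
Definition JS_children (u : seq nat) : seq (seq nat) :=
  if odd (size u) then
    rcons [seq first_child_or_self (rcons u i) | i <- iota 0 (outdeg T u)]
          (next_sibling_or_parent u)
  else [::].

Definition JS : plane_tree :=
  if outdeg T [::] == 0%N then Node [::]
  else explore JS_children (size (vertices T)) [:: 0%N].

End JansonStefansson.

Definition NC_tree (R : realType) n (P : {set {set 'I_n}}) : plane_tree :=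
  JS (dual_tree R P).

(* Main.v *)
Require Import Defs.
From mathcomp Require Import all_boot all_order all_algebra.
From mathcomp Require Import all_classical all_reals all_analysis.
From mathcomp Require Import zify ring lra.

(* Number the vertices of a plane tree with n + 1 vertices from 0 in preorder
   and call two non-root vertices equivalent when they are siblings: this gives
   a non-crossing partition of {1, ..., n} whose blocks are the sets of children
   of the internal vertices, so that it has the same weight as the tree because
   w(0) = 1.  Every non-crossing partition arises once in this way, and the tree
   it comes from is its image by the Janson-Stefansson bijection applied to the
   dual tree: in an interval that is a union of blocks, both constructions split
   off the part following the last element of the block of the first point.
   The geometry enters only through the chord joining the midpoints of two arcs.
   If no block has points on both sides of it, then it avoids all hulls and joins
   the two arcs inside one face; otherwise a segment joining two points of one
   block separates the two arcs. *)

Set Implicit Arguments.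
Unset Strict Implicit.
Unset Printing Implicit Defensive.

Import Order.TTheory GRing.Theory Num.Theory.
Import numFieldNormedType.Exports.
Local Open Scope classical_set_scope.
Local Open Scope ring_scope.

(** * Plane trees and the Janson-Stefansson bijection *)

(** Detaching the last subtree of the root leaves two smaller trees; this is the recursion along
    which [parents] and the dual tree decompose. *)
Lemma plane_tree_rcons_ind (Q : plane_tree -> Prop) :
  Q (Node [::]) -> (forall s x, Q (Node s) -> Q x -> Q (Node (rcons s x))) ->
  forall t, Q t.
Proof.
move=> Q0 QS; fix IH 1 => -[s].
(* The inner induction carries a prefix [a] with [Q (Node a)], at first empty, to which the subtrees
   are appended one by one. *)
rewrite -[s]cats0 -[s ++ _]/([::] ++ s ++ [::]) cats0.
elim: s [::] Q0 => [|x s IHs] a Qa; first by rewrite cats0.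
by rewrite -cat_rcons; apply: IHs; apply: QS.
Qed.

Fixpoint tree_size (t : plane_tree) : nat :=
  let: Node s := t in (sumn [seq tree_size u | u <- s]).+1.

Lemma tree_size_gt0 t : (0 < tree_size t)%N.
Proof. by case: t. Qed.

Lemma tree_size_rcons s x :
  tree_size (Node (rcons s x)) = (tree_size (Node s) + tree_size x)%N.
Proof. by rewrite /= map_rcons -cats1 sumn_cat /= addn0. Qed.

(** A named copy of the fixpoint local to [vertices]. *)
Fixpoint forest_vertices (i : nat) (s : seq plane_tree) : seq (seq nat) :=
  if s is t :: s' then [seq i :: u | u <- vertices t] ++ forest_vertices i.+1 s'
  else [::].

Lemma verticesE s : vertices (Node s) = [::] :: forest_vertices 0 s.
Proof. by congr cons; elim: s 0%N => //= t s IHs i; rewrite IHs. Qed.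

Lemma size_vertices t : size (vertices t) = tree_size t.
Proof.
elim/plane_tree_rcons_ind: t => // s x; rewrite !verticesE /= => -[IHs] IHx.
have H i r y : size (forest_vertices i (rcons r y)) =
    (size (forest_vertices i r) + size (vertices y))%N.
  elim: r i => [|z r IHr] i /=; first by rewrite size_cat size_map addnC.
  by rewrite !size_cat IHr addnA.
by rewrite H IHs IHx -addSn /= map_rcons -cats1 sumn_cat /= addn0.
Qed.

Lemma tree_weight_Node (R : realType) (w : nat -> R) s :
  tree_weight w (Node s) = w (size s) * \prod_(t <- s) tree_weight w t.
Proof.
rewrite /tree_weight verticesE big_cons; congr (_ * _).
(* Outdegrees are read in the whole tree, so the induction keeps the subtrees already passed as a
   prefix [a], whose size is the current position. *)
rewrite (eq_bigr (fun u => w (outdeg (Node ([::] ++ s)) u))) //.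
rewrite -[0%N]/(size (@nil plane_tree)).
elim: s [::] => [|t s IHs] a; first by rewrite /= !big_nil.
rewrite /= big_cat big_map big_cons -[(size a).+1](size_rcons a t).
rewrite -cat_rcons IHs; congr (_ * _); apply: eq_bigr => u _.
by rewrite /outdeg /subtree /= cat_rcons nth_cat ltnn subnn.
Qed.

(* [white_contract] is [G] read on the subtree of a vertex at even generation:
   each odd child becomes an internal vertex whose last child is the next odd
   sibling, the parent itself closing the chain as a leaf. *)
Fixpoint white_contract (t : plane_tree) : plane_tree :=
  let: Node s := t in
  foldr (fun b r => let: Node c := b in
           Node (rcons [seq white_contract v | v <- c] r)) (Node [::]) s.

Lemma white_contract_cons c s :
  white_contract (Node (Node c :: s)) =
  Node (rcons [seq white_contract v | v <- c] (white_contract (Node s))).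
Proof. by []. Qed.

(** Started at child [j] of a vertex [u] at even generation, the exploration uses exactly the
    subtrees of [u] from position [j] on and yields their contraction; their total size bounds the
    depth needed. *)
Lemma JS_white_contract T : JS T = white_contract T.
Proof.
have subr u j : subtree T (rcons u j) = nth (Node [::]) (children (subtree T u)) j.
  by rewrite /subtree -cats1 foldl_cat.
have leaf d u : ~~ odd (size u) -> explore (JS_children T) d u = Node [::].
  by case: d => // d /negbTE u2; rewrite /= /JS_children u2.
have chain d u j : ~~ odd (size u) -> (j < outdeg T u)%N ->
    (sumn [seq tree_size t | t <- drop j (children (subtree T u))] <= d)%N ->
  explore (JS_children T) d (rcons u j) =
    white_contract (Node (drop j (children (subtree T u)))).
  elim: d u j => [|d IHd] u j u2 ju;
    rewrite (drop_nth (Node [::])) //= -subr; set b := subtree T (rcons u j);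
    have := tree_size_gt0 b; case Eb: b => [c] /=; first by lia.
  move=> _ le_d; congr Node.
  rewrite /JS_children size_rcons /= u2 map_rcons -map_comp; congr rcons.
    rewrite /outdeg -/b Eb /= -[in RHS](mkseq_nth (Node [::]) c) -map_comp.
    apply/eq_in_map => i; rewrite mem_iota /= add0n => ic.
    have Ei : subtree T (rcons (rcons u j) i) = nth (Node [::]) c i.
      by rewrite subr -/b Eb.
    have i2 : ~~ odd (size (rcons (rcons u j) i)) by rewrite !size_rcons /= negbK.
    rewrite /first_child_or_self /outdeg Ei.
    case Ev: (nth (Node [::]) c i) => [[|v0 v]] //=; first by rewrite leaf.
    rewrite (IHd _ 0%N) ?/outdeg ?Ei ?Ev // drop0.
    have : (tree_size (nth (Node [::]) c i) <= sumn [seq tree_size t | t <- c])%N.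
      rewrite -[c in leqRHS](cat_take_drop i) map_cat sumn_cat (drop_nth (Node [::])) //=.
      by lia.
    by rewrite Ev /=; lia.
  rewrite /next_sibling_or_parent /parent size_rcons last_rcons /=.
  rewrite -cats1 take_size_cat // /outdeg.
  (* Either the next sibling continues the chain, or the parent [u], at even generation, closes it
     as a leaf. *)
  case: ltnP => [ju'|uj]; first by rewrite IHd //; lia.
  by rewrite leaf // drop_oversize.
case: T {subr leaf} chain => [[|t s]] // chain.
have := chain (size (vertices (Node (t :: s)))) [::] 0%N isT isT.
by rewrite drop0 size_vertices -size_vertices; apply; rewrite size_vertices leqnSn.
Qed.

(** * Preorder and siblings *)

(* With the vertices numbered from 0 in preorder, the i-th entry of [parents t]
   is the number of the parent of vertex i.+1. *)
Fixpoint parents (t : plane_tree) : seq nat :=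
  let: Node s := t in
  foldl (fun p u => p ++ 0%N :: [seq ((size p).+1 + v)%N | v <- parents u]) [::] s.

Arguments parents : simpl never.
Arguments tree_size : simpl never.

Definition parent_of (t : plane_tree) (i : nat) : nat := nth 0%N (parents t) i.

Lemma parents_rcons s x : parents (Node (rcons s x)) =
  parents (Node s) ++
    0%N :: [seq ((size (parents (Node s))).+1 + v)%N | v <- parents x].
Proof. by rewrite /parents foldl_rcons. Qed.

Lemma size_parents t : (size (parents t)).+1 = tree_size t.
Proof.
elim/plane_tree_rcons_ind: t => // s x IHs IHx.
by rewrite tree_size_rcons -IHs -IHx parents_rcons size_cat [size (_ :: _)]/= size_map.
Qed.

Section ParentRcons.
Variables (s : seq plane_tree) (x : plane_tree).
Let m := size (parents (Node s)).

Lemma parent_of_rcons_lt i : (i < m)%N ->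
  parent_of (Node (rcons s x)) i = parent_of (Node s) i.
Proof. by move=> im; rewrite /parent_of parents_rcons nth_cat im. Qed.

Lemma parent_of_rcons_eq : parent_of (Node (rcons s x)) m = 0%N.
Proof. by rewrite /parent_of parents_rcons nth_cat ltnn subnn. Qed.

Lemma parent_of_rcons_gt i : (i < size (parents x))%N ->
  parent_of (Node (rcons s x)) (m.+1 + i) = (m.+1 + parent_of x i)%N.
Proof.
move=> ix; rewrite /parent_of parents_rcons nth_cat ltnNge addSnnS leq_addr /=.
by rewrite addKn /= (nth_map 0%N).
Qed.

End ParentRcons.

Lemma size_parents_rcons s x : size (parents (Node (rcons s x))) =
  ((size (parents (Node s))).+1 + size (parents x))%N.
Proof. by rewrite parents_rcons size_cat /= size_map addnS. Qed.

(** In preorder, vertex [i.+1] comes before the root of [x], is that root, or lies strictly below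
    it. *)
Variant parent_of_rcons_spec s x (m := size (parents (Node s))) :
    nat -> nat -> Prop :=
  | ParentLt i of (i < m)%N : parent_of_rcons_spec s x i (parent_of (Node s) i)
  | ParentEq : parent_of_rcons_spec s x m 0
  | ParentGt i of (i < size (parents x))%N :
      parent_of_rcons_spec s x (m.+1 + i) (m.+1 + parent_of x i).

Lemma parent_of_rconsP s x i : (i < size (parents (Node (rcons s x))))%N ->
  parent_of_rcons_spec s x i (parent_of (Node (rcons s x)) i).
Proof.
rewrite size_parents_rcons; set m := size _ => ilt; have [im|mi|->] := ltngtP i m.
- by rewrite parent_of_rcons_lt //; constructor.
- by rewrite -(subnKC mi) parent_of_rcons_gt; [constructor; lia|lia].
- by rewrite parent_of_rcons_eq; constructor.
Qed.

Lemma parent_of_le t i : (parent_of t i <= i)%N.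
Proof.
elim/plane_tree_rcons_ind: t i => [|s x IHs IHx] i; first by rewrite /parent_of nth_nil.
have [ilt|le_i] := ltnP i (size (parents (Node (rcons s x)))); last first.
  by rewrite /parent_of nth_default.
by case: (parent_of_rconsP ilt) => // j jx; rewrite leq_add2l.
Qed.

Lemma parent_of0 t : parent_of t 0 = 0%N.
Proof. by apply/eqP; rewrite -leqn0 parent_of_le. Qed.

(* In preorder, the vertices strictly between two siblings are descendants of
   their parent, so their parents come no earlier. *)
Lemma parent_of_between t i j k :
  (i < j)%N -> (j < k)%N -> (k < size (parents t))%N ->
  parent_of t i = parent_of t k -> (parent_of t i <= parent_of t j)%N.
Proof.
elim/plane_tree_rcons_ind: t i j k => [//|s x IHs IHx] i j k ij jk kt.
have jt := ltn_trans jk kt; have it := ltn_trans ij jt.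
have lei := parent_of_le (Node s).
case: (parent_of_rconsP kt) jk => [k' k's jk'||k' k'x jk'].
- rewrite !parent_of_rcons_lt; [exact: IHs|lia|lia].
- by move=> _ ->.
- case: (parent_of_rconsP it) ij => [i' i's||i' i'x]; first by have := lei i'; lia.
    by [].
  case: (parent_of_rconsP jt) jk' => [j' j's||j' j'x]; [lia|lia|].
  by rewrite !ltn_add2l leq_add2l => jk' ij' /addnI; apply: IHx jk' k'x.
Qed.

Lemma count_parents0 s : count_mem 0%N (parents (Node s)) = size s.
Proof.
elim/last_ind: s => // s x IHs; rewrite parents_rcons count_cat IHs size_rcons /=.
by rewrite count_map (eq_count (a2 := pred0)) ?count_pred0 ?addn0 ?addn1.
Qed.

(** The multiplicity of [v] among the parents is its outdegree. Detaching [x] changes only the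
    outdegree of the root, so the root is treated apart and the induction bears on the other
    vertices. *)
Lemma tree_weight_parents (R : realType) (w : nat -> R) t :
  tree_weight w t = \prod_(0 <= v < tree_size t) w (count_mem v (parents t)).
Proof.
have root s : (\prod_(1 <= v < tree_size (Node s)) w (count_mem v (parents (Node s)))
      = \prod_(u <- s) tree_weight w u) -> tree_weight w (Node s) =
    \prod_(0 <= v < tree_size (Node s)) w (count_mem v (parents (Node s))).
  by move=> E; rewrite big_ltn // count_parents0 E tree_weight_Node.
suff main t' : \prod_(1 <= v < tree_size t') w (count_mem v (parents t'))
    = \prod_(u <- children t') tree_weight w u.
  by case: t => s; apply/root/(main (Node s)).
elim/plane_tree_rcons_ind: t' => [|s x IHs IHx].
  by rewrite big_geq //= big_nil.
(* Parents precede their children, so the last vertex in preorder has no child, and larger numbers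
   do not occur. *)
have count_gt (u : plane_tree) v : (size (parents u) <= v)%N -> (0 < v)%N ->
    count_mem v (parents u) = 0%N.
  move=> le_v v0; apply/count_memPn/negP => /(nthP 0%N)[i iu E].
  by have := leq_ltn_trans (parent_of_le u i) iu; rewrite /parent_of E ltnNge le_v.
rewrite big_rcons -IHs tree_size_rcons (big_cat_nat (n := tree_size (Node s)));
  [|exact: tree_size_gt0|exact: leq_addr].
have shift N k (F : nat -> R) :
    \prod_(N <= i < N + k) F i = \prod_(0 <= i < k) F (i + N)%N.
  by rewrite -{1}[N]add0n big_addn addKn.
congr (_ * _).
  apply: eq_big_nat => v /andP[v0 vs]; congr w.
  have v_small : (v < (size (parents (Node s))).+1)%N by rewrite size_parents.
  rewrite parents_rcons count_cat /= (_ : (0%N == v) = false) ?count_map; last by lia.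
  rewrite [X in (_ + (_ + X))%N](_ : _ = 0%N) ?addn0 //.
  by apply/eqP; rewrite -leqn0 leqNgt -has_count; apply/hasPn => u _ /=; lia.
rewrite shift; case: x IHx => c IHx; rewrite root //; apply: eq_big_nat => v /andP[_ vx].
congr w; rewrite parents_rcons count_cat count_gt; [|by rewrite -size_parents; lia..].
rewrite -size_parents /= count_map add0n.
rewrite (_ : (0%N == _) = false); last by lia.
by apply: eq_count => u /=; rewrite [(v + _)%N]addnC eqn_add2l.
Qed.

(* Non-crossing partitions of an interval are built by splitting off the part
   following the last element of the block of the first one. *)
Lemma noncrossing_parent_of (e : rel nat) (a m : nat) :
  reflexive e -> symmetric e -> transitive e ->
  (forall i j k l, (a <= i < j)%N -> (j < k < l)%N -> (l < a + m)%N ->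
     e i k -> e j l -> e i j) ->
  exists2 t, size (parents t) = m &
    forall i j, (i < m)%N -> (j < m)%N ->
      e (a + i)%N (a + j)%N = (parent_of t i == parent_of t j).
Proof.
move=> er es et.
elim/ltn_ind: m a => -[|m] IHm a nc; first by exists (Node [::]).
have exa : exists c, (c <= m)%N && e a (a + c)%N.
  by exists 0%N; rewrite addn0 er.
have bnd c : (c <= m)%N && e a (a + c)%N -> (c <= m)%N by case/andP.
(* [c] is the largest offset of a point equivalent to [a]. The points before and after [a + c] are
   handled by induction, and [a + c] becomes the root of the last subtree. *)
case: (ex_maxnP exa bnd) => c /andP[cm eac] cmax.
have [|[s] ss es1] := IHm c cm a.
  by move=> i j k l ? ? ?; apply: (nc i j k l) => //; lia.
have mc : (m - c < m.+1)%N by lia.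
have [|x sx ex] := IHm _ mc (a + c).+1.
  by move=> i j k l ? ? ?; apply: (nc i j k l) => //; lia.
subst c; set c := size (parents (Node s)) in cm eac cmax es1 mc sx ex *.
have st : size (parents (Node (rcons s x))) = m.+1.
  by rewrite size_parents_rcons sx; lia.
exists (Node (rcons s x)) => // i j.
have root i' : (i' < c)%N -> e (a + i')%N (a + c)%N = (parent_of (Node s) i' == 0%N).
  move=> i'c; rewrite -(parent_of0 (Node s)) -es1 //; last by lia.
  by rewrite addn0; apply/idP/idP => h; [apply: (et (a + c)%N) h _|apply: (et a) h _];
    rewrite // es.
have gtc k : (k < size (parents x))%N -> e a (a + c.+1 + k)%N = false.
  move=> kx; apply/negP => h; suff: (c.+1 + k <= c)%N by lia.
  by apply: cmax; rewrite addnA h; lia.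
(* Otherwise this class would cross the pair [a], [a + c], hence be the class of [a], against the
   maximality of [c]. *)
have cross i' k : (i' < c)%N -> (k < size (parents x))%N ->
    e (a + i')%N (a + c.+1 + k)%N = false.
  move=> i'c kx; apply/negP => h.
  suff /(et _ _ _)/(_ h) : e a (a + i')%N by rewrite gtc.
  case: i' i'c h => [|i'] i'c h; first by rewrite addn0 er.
  by apply: (nc a _ (a + c)%N _ _ _ _ eac h); lia.
rewrite -st => it jt.
have les := parent_of_le (Node s).
case: (parent_of_rconsP it) => [i' i's||i' i'x];
  case: (parent_of_rconsP jt) => [j' j's||j' j'x].
- by rewrite es1.
- exact: root.
- by rewrite addnA cross //; have := les i'; lia.
- by rewrite es root // eq_sym.
- by rewrite er eqxx.
- by rewrite addnA; apply/negbTE/negP => /(et _ _ _ eac); rewrite gtc.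
- by rewrite es addnA cross //; have := les j'; lia.
- by rewrite es addnA; apply/negbTE/negP => /(et _ _ _ eac); rewrite gtc.
- rewrite eqn_add2l -ex; [|lia..].
  by rewrite !addnS !addSn !addnA.
Qed.

(** * The dual tree *)

Lemma mem_filter_enum (T : finType) (p : pred T) (i : T) :
  (i \in [seq l <- enum T | p l]) = p i.
Proof. by rewrite mem_filter mem_enum andbT. Qed.

(** Both sides are strictly increasing and have the same elements. *)
Lemma filter_enum_ord_split n (p : pred 'I_n) (c : 'I_n) : p c ->
  [seq l : 'I_n <- enum 'I_n | p l] =
  [seq l : 'I_n <- enum 'I_n | (l < c)%N && p l] ++
    c :: [seq l : 'I_n <- enum 'I_n | (c < l)%N && p l].
Proof.
move=> pc; have tr : transitive (fun i j : 'I_n => (i < j)%N).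
  by move=> j i k; apply: ltn_trans.
have st (q : pred 'I_n) :
    pairwise (fun i j : 'I_n => (i < j)%N) [seq l : 'I_n <- enum 'I_n | q l].
  apply: pairwise_filter; rewrite -(sorted_pairwise tr).
  by have := iota_ltn_sorted 0 n; rewrite -val_enum_ord sorted_map.
apply: (irr_sorted_eq tr); first by move=> i; rewrite /= ltnn.
- by rewrite (sorted_pairwise tr).
- rewrite (sorted_pairwise tr) pairwise_cat pairwise_cons !st !andbT.
  apply/andP; split.
    apply/allrelP => i j; rewrite in_cons !mem_filter_enum => /andP[ic _].
    by case/predU1P => [->//|/andP[cj _]]; apply: ltn_trans cj.
  by apply/allP => j; rewrite mem_filter_enum => /andP[].
- move=> l; rewrite mem_cat in_cons !mem_filter_enum.
  by rewrite -val_eqE /=; case: (ltngtP l c) => [||/val_inj ->] //=; rewrite orbF.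
Qed.

Lemma exploreS (V : Type) (ch : V -> seq V) d r :
  explore ch d.+1 r = Node [seq explore ch d v | v <- ch r].
Proof. by []. Qed.

Section DualTree.
Variables (R : realType) (n : nat) (P : {set {set 'I_n}}).
Hypothesis P_part : finset.partition P [set: 'I_n]%SET.

Definition same (i j : 'I_n) : bool := finset.pblock P i == finset.pblock P j.

Lemma mem_pblock_same i j : (i \in finset.pblock P j) = same i j.
Proof.
case/and3P: P_part => /eqP Pc Pt _.
by rewrite /same eq_sym eq_pblock // Pc inE.
Qed.

Lemma same_sym i j : same i j = same j i. Proof. exact: eq_sym. Qed.

Lemma same_eqr i j k : same j k -> same i j = same i k.
Proof. by rewrite /same => /eqP ->. Qed.

(** Ordinals count from 0, so [[a, b)] holds the labels from [a + 1] to [b], those between the arcs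
    [a] and [b]; the condition makes this set a union of blocks. *)
Definition block_closed (a b : nat) : bool :=
  [forall i : 'I_n, forall j : 'I_n,
     same i j ==> ((a <= i < b)%N == (a <= j < b)%N)].

Lemma block_closedP a b :
  reflect (forall i j : 'I_n, same i j -> (a <= i < b)%N = (a <= j < b)%N)
          (block_closed a b).
Proof.
apply: (iffP forallP) => [h i j ij|h i]; last first.
  by apply/forallP => j; apply/implyP => ij; rewrite (h i j).
by move/forallP/(_ j)/implyP/(_ ij)/eqP: (h i).
Qed.

Lemma block_closed_intro a b :
  (forall i j : 'I_n, same i j -> (a <= i < b)%N -> (a <= j < b)%N) -> block_closed a b.
Proof.
by move=> h; apply/block_closedP => i j ij; apply/idP/idP; apply: h; rewrite // same_sym.
Qed.

Lemma block_closed_extend a b c : (a <= b <= c)%N ->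
  block_closed a b -> block_closed a c = block_closed b c.
Proof.
move=> abc /block_closedP ab; apply/block_closedP/block_closedP => h i j ij;
  by move: (ab _ _ ij) (h _ _ ij); lia.
Qed.

Lemma block_closed0n : block_closed 0 n.
Proof. by apply/block_closedP => i j _; rewrite !ltn_ord. Qed.

(** Point [i] of the interval is vertex [i - a + 1] of [t]. The interval need not be a union of
    blocks: a block may also have elements outside it. *)
Definition represents (a : nat) (t : plane_tree) : Prop :=
  (a + size (parents t) <= n)%N /\
  forall i j : 'I_n, (a <= i < a + size (parents t))%N ->
    (a <= j < a + size (parents t))%N ->
    same i j = (parent_of t (i - a) == parent_of t (j - a)).

(** * Cutting an interval at the last child of the root *)

Section Split.
Variables (a : nat) (s : seq plane_tree) (x : plane_tree) (c : 'I_n).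
Hypothesis cE : (c = a + size (parents (Node s)) :> nat)%N.
Hypothesis rep : represents a (Node (rcons s x)).

Let parentE (i : 'I_n) : (a <= i < c.+1 + size (parents x))%N ->
  parent_of (Node (rcons s x)) (i - a) =
    if (i < c)%N then parent_of (Node s) (i - a)
    else if i == c then 0%N else ((c - a).+1 + parent_of x (i - c.+1))%N.
Proof.
move=> ai; have sc : size (parents (Node s)) = (c - a)%N by lia.
case: (ltngtP i c) => ic.
- by rewrite parent_of_rcons_lt //; lia.
- rewrite (_ : (i == c) = false); last by apply/eqP => E; rewrite E ltnn in ic.
  have -> : (i - a = (size (parents (Node s))).+1 + (i - c.+1))%N by lia.
  by rewrite parent_of_rcons_gt ?sc //; lia.
- by rewrite (val_inj ic) eqxx -sc parent_of_rcons_eq.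
Qed.

Let endE : (a + size (parents (Node (rcons s x))) = c.+1 + size (parents x))%N.
Proof. by rewrite size_parents_rcons cE addnA addnS. Qed.

Let sameE (i j : 'I_n) : (a <= i < c.+1 + size (parents x))%N ->
    (a <= j < c.+1 + size (parents x))%N ->
  same i j = (parent_of (Node (rcons s x)) (i - a) ==
              parent_of (Node (rcons s x)) (j - a)).
Proof. by case: rep => _; rewrite endE; apply. Qed.

Lemma represents_init : represents a (Node s).
Proof.
have [an _] := rep; split; first by move: an; rewrite endE; lia.
by move=> i j ai aj; rewrite sameE ?parentE; try lia; rewrite !ifT //; lia.
Qed.

Lemma represents_last : represents c.+1 x.
Proof.
have [an _] := rep; split; first by move: an; rewrite endE.
move=> i j ai aj; rewrite sameE ?parentE; try lia.
have gt (k : 'I_n) : (c < k)%N -> ((k < c)%N = false) /\ (k == c = false).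
  by move=> ck; split; [lia|apply/eqP => E; rewrite E ltnn in ck].
have [-> ->] := gt i ltac:(lia); have [-> ->] := gt j ltac:(lia).
by rewrite eqn_add2l.
Qed.

Lemma same_lt_split (i : 'I_n) : (a <= i < c)%N ->
  same i c = (parent_of (Node s) (i - a) == 0%N).
Proof.
by move=> ai; rewrite sameE ?parentE; try lia; rewrite ltnn eqxx ifT //; lia.
Qed.

(** Up to [c], parents are numbered at most [c - a]; after [c], they lie in the last subtree and
    have larger numbers. *)
Lemma same_gt_split (i j : 'I_n) : (a <= i <= c)%N ->
  (c < j < c.+1 + size (parents x))%N -> same i j = false.
Proof.
move=> ai aj; rewrite sameE ?parentE; try lia.
rewrite [X in _ == X]ifF; last by lia.
rewrite [X in _ == X]ifF; last by apply/eqP => E; move: aj; rewrite E; lia.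
have := parent_of_le (Node s) (i - a).
by case: (ltngtP i c) => [ic|ic|/val_inj ->]; rewrite ?eqxx; lia.
Qed.

Lemma same_first (i : 'I_n) : i = a :> nat -> same i c.
Proof.
move=> ia; have [ic|ci] := ltnP i c.
  by rewrite same_lt_split ?ia ?subnn ?parent_of0 //; lia.
have /val_inj -> : i = c :> nat by lia.
exact: eqxx.
Qed.

Lemma block_closed_split :
  block_closed a (c.+1 + size (parents x)) -> block_closed a c.+1.
Proof.
move=> /block_closedP h; apply: block_closed_intro => i j ij ai.
have := h _ _ ij; have [cj|] := ltnP c j; last by lia.
by move=> hj; move: ij; rewrite same_gt_split //; lia.
Qed.

End Split.

(** By [faceE], for [0 < a] these are the [l] whose following arc lies in the same face as arc [a].
    Each is the last element of its block, so these edges lead to distinct blocks. *)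
Definition closing (a b : nat) : seq 'I_n :=
  [seq l : 'I_n <- enum 'I_n | (a <= l < b)%N && block_closed a l.+1].

Lemma closing_nil a : closing a a = [::].
Proof.
by apply/eqP; rewrite -(negbK (_ == _)) -has_filter; apply/hasPn => l _; lia.
Qed.

Lemma closing_split a s x (c : 'I_n) :
  (c = a + size (parents (Node s)) :> nat)%N ->
  represents a (Node (rcons s x)) ->
  block_closed a (c.+1 + size (parents x)) ->
  closing a (c.+1 + size (parents x)) =
    c :: closing c.+1 (c.+1 + size (parents x)).
Proof.
move=> cE rep cl; have ac := block_closed_split cE rep cl.
rewrite /closing (filter_enum_ord_split (c := c)); last by rewrite ac andbT; lia.
rewrite (eq_filter (a2 := pred0)) ?filter_pred0 => [|l /=].
  congr cons; apply: eq_filter => l /=; case: ltnP => cl' //=.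
  by rewrite (block_closed_extend _ ac); [congr andb; lia|lia].
apply/negP => /and3P[lc al /block_closedP].
have an : (a < n)%N by have := ltn_ord c; lia.
move/(_ (Ordinal an) c); rewrite (same_first cE rep) //= => /(_ isT).
by lia.
Qed.

Local Notation face l := (@white_face R n P l).

(** The only geometric input of this section; [face_eqE] supplies it for every partition. *)
Hypothesis faceE : forall k m : nat, (0 < k)%N -> (k <= m)%N -> (m <= n)%N ->
  `[< face k = face m >] = block_closed k m.

Let faceE_sym (k m : nat) : (0 < k)%N -> (k <= m)%N -> (m <= n)%N ->
  `[< face m = face k >] = block_closed k m.
Proof.
by move=> k0 km mn; rewrite -faceE //; apply: asbool_equiv_eq; split=> ->.
Qed.

Let black_tree d l := explore (dual_children (R := R) P) d (inl (finset.pblock P l), Some l).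
Let white_tree d (l : 'I_n) :=
  explore (dual_children (R := R) P) d (inr (face (label l)), Some l).

(** Describes what hangs below a white vertex, whose edges other than the one to its parent are
    listed by [closing]. *)
Let black_spec t := forall a d,
  represents a t -> block_closed a (a + size (parents t)) -> (tree_size t <= d.+1)%N ->
  white_contract
    (Node [seq black_tree d l | l <- closing a (a + size (parents t))]) = t.

(** Describes what hangs below the block of [c]. The children of the root of [t] are the elements of
    that block in [[a, c)], and every other block meeting this interval is contained in it. *)
Let white_spec t := forall a d (c : 'I_n),
  (c = a + size (parents t) :> nat)%N -> represents a t ->
  (forall i : 'I_n, (a <= i < c)%N -> parent_of t (i - a) = 0%N -> same i c) ->
  (forall i j : 'I_n, (a <= i < c)%N -> parent_of t (i - a) != 0%N -> same i j ->
     (a <= j < c)%N) ->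
  (tree_size t <= d.+1)%N ->
  [seq white_contract (white_tree d l)
     | l : 'I_n <- enum 'I_n & (a <= l < c)%N && same l c] = children t.

(** The two statements feed each other. At a white vertex the first edge leads to the block ending
    at [c], whose white children give the subtrees of [Node s], and the remaining edges give [x]. At
    a black vertex the edge of the last point [c'] leads to the face that gives [x]. *)
Lemma dual_tree_spec t : black_spec t /\ white_spec t.
Proof.
elim/plane_tree_rcons_ind: t => [|s x [bs ws] [bx wx]]; split.
- by move=> a d _ _ _; rewrite addn0 closing_nil.
- move=> a d c cE _ _ _ _; rewrite addn0 in cE.
  rewrite (eq_filter (a2 := pred0)) ?filter_pred0 // => l /=.
  by rewrite cE; apply/negP => /andP[]; lia.
- move=> a d rep; have [an _] := rep.
  have cn : (a + size (parents (Node s)) < n)%N.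
    by move: an; rewrite size_parents_rcons; lia.
  pose c := Ordinal cn; have cE : c = (a + size (parents (Node s)))%N :> nat by [].
  have -> : (a + size (parents (Node (rcons s x))) = c.+1 + size (parents x))%N.
    by rewrite size_parents_rcons cE; lia.
  move=> cl; have ac := block_closed_split cE rep cl.
  rewrite tree_size_rcons (closing_split cE) //.
  have := tree_size_gt0 x; have := tree_size_gt0 (Node s).
  case: d => [|d] s0 x0 sd; first by lia.
  rewrite map_cons; set rest := [seq _ | _ <- _].
  (* [c] is the largest element of its block, so the edges following the parent edge [c] clockwise
     are the others in increasing order. *)
  have edges : dual_edges P (inl (finset.pblock P c) : dual_vertex R n) =
      [seq l : 'I_n <- enum 'I_n | (a <= l < c)%N && same l c] ++ [:: c].
    rewrite /= (filter_enum_ord_split (c := c)); last by rewrite mem_pblock_same /same.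
    congr (_ ++ _ :: _).
      apply: eq_filter => l; rewrite mem_pblock_same.
      case lc: (same l c); rewrite ?andbF ?andbT //.
      by move/block_closedP: ac => /(_ _ _ lc); lia.
    rewrite (eq_filter (a2 := pred0)) ?filter_pred0 // => l /=.
    rewrite mem_pblock_same; apply/negP => /andP[cl' lc].
    by move/block_closedP: ac => /(_ _ _ lc); lia.
  have -> : black_tree d.+1 c = Node [seq white_tree d l
      | l : 'I_n <- enum 'I_n & (a <= l < c)%N && same l c].
    rewrite /black_tree exploreS /dual_children edges.
    rewrite index_cat mem_filter_enum ltnn andbF /= eqxx addn0 rot_size_cat /=.
    by rewrite -map_comp.
  rewrite white_contract_cons -map_comp.
  rewrite (ws a d c) //; last by lia.
  - by congr (Node (rcons _ _)); apply: bx => //; [exact: represents_last cE rep|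
      rewrite -(block_closed_extend _ ac)//; lia|lia].
  - exact: represents_init cE rep.
  - by move=> i ai i0; rewrite (same_lt_split cE rep) // i0.
  - move=> i j ai i0 ij; have ji : same j i by rewrite same_sym.
    move/block_closedP: ac => /(_ _ _ ij); rewrite (_ : (a <= i < c.+1)%N); last by lia.
    move=> /esym aj; suff : j != c by rewrite -val_eqE /=; lia.
    by apply: contraNneq i0 => jc; rewrite -(same_lt_split cE rep) // -jc.
- move=> a d c cE rep roots inner; rewrite tree_size_rcons => sd.
  have c'c : (a + size (parents (Node s)) < c)%N.
    by rewrite cE size_parents_rcons; lia.
  pose c' := Ordinal (ltn_trans c'c (ltn_ord c)).
  have c'E : c' = (a + size (parents (Node s)))%N :> nat by [].
  have cE' : (c = c'.+1 + size (parents x) :> nat)%N.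
    by rewrite cE size_parents_rcons c'E; lia.
  have sc' : same c' c.
    by apply: roots; [rewrite c'E; lia|rewrite c'E addKn parent_of_rcons_eq].
  (* The points strictly between [c'] and [c] are the non-root vertices of the last subtree; their
     blocks stay in this gap. *)
  have gt_inner (i j : 'I_n) : (c' < i < c)%N -> same i j -> (c' < j < c)%N.
    move=> ci ij; have : (a <= j < c)%N.
      apply: inner ij; first by rewrite c'E in ci; lia.
      have -> : (i - a = (size (parents (Node s))).+1 + (i - c'.+1))%N by lia.
      by rewrite parent_of_rcons_gt; lia.
    have [|jc] := ltnP c' j; first by lia.
    by move=> aj; move: ij; rewrite same_sym (same_gt_split c'E rep) //; lia.
  have not_c (i : 'I_n) : (c' < i < c)%N -> same i c = false.
    by move=> ci; apply/negP => /(gt_inner _ _ ci); lia.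
  rewrite (filter_enum_ord_split (c := c')); last by rewrite sc' andbT c'E; lia.
  rewrite [X in _ ++ _ :: X](eq_filter (a2 := pred0)) ?filter_pred0 => [|l /=]; last first.
    by apply/negP => /and3P[cl al]; rewrite not_c //; lia.
  rewrite (eq_filter (a2 := fun l : 'I_n => (a <= l < c')%N && same l c')) => [|l]; last first.
    by rewrite (same_eqr _ sc'); case: same; rewrite ?andbF ?andbT //; lia.
  rewrite map_cat (ws a d c') //; first last.
  - by have := tree_size_gt0 x; lia.
  - move=> i j ai i0 ij.
    have aj : (a <= j < c)%N.
      by apply: inner ij; [lia|rewrite parent_of_rcons_lt //; lia].
    case: (ltngtP j c') => [|jc|/val_inj jc]; first by lia.
      by move: ij; rewrite (same_gt_split c'E rep) //; lia.
    by move: ij i0; rewrite jc (same_lt_split c'E rep) // => ->.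
  - by move=> i ai i0; rewrite (same_lt_split c'E rep) // i0.
  - exact: represents_init c'E rep.
  rewrite /= cats1; congr rcons.
  case: d sd => [|d] sd.
    by have := tree_size_gt0 x; have := tree_size_gt0 (Node s); lia.
  (* An arc before [c'] or after a point from [c] on is in another face: otherwise a union of blocks
     would contain exactly one of [c'] and [c], which share a block. *)
  have edges : dual_edges P (inr (face (label c')) : dual_vertex R n) =
      c' :: closing c'.+1 (c'.+1 + size (parents x)).
    rewrite /= (filter_enum_ord_split (c := c')); last exact/asboolP.
    rewrite (eq_filter (a2 := pred0)) ?filter_pred0 => [|l /=].
      congr (_ :: _); apply: eq_filter => l /=; case: ltnP => //= cl.
      rewrite faceE_sym //; [|by rewrite /label; lia|exact: ltn_ord].
      case: ltnP => //= lc; apply/negP => /block_closedP/(_ _ _ sc').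
      by rewrite -cE' in lc; rewrite /label /=; lia.
    case: ltnP => //= lc.
    rewrite faceE //; [|by rewrite /label; lia|exact: ltn_ord].
    by apply/negP => /block_closedP/(_ _ _ sc'); rewrite /label /=; lia.
  have -> : white_tree d.+1 c' =
      Node [seq black_tree d l | l <- closing c'.+1 (c'.+1 + size (parents x))].
    rewrite /white_tree exploreS /dual_children edges.
    by rewrite /= eqxx rot0 /= -map_comp.
  apply: bx; [exact: represents_last c'E rep| |by have := tree_size_gt0 (Node s); lia].
  by rewrite -cE'; apply: block_closed_intro => i j ij ci; apply: gt_inner ij.
Qed.

Lemma NC_tree_represented t :
  size (parents t) = n -> (0 < n)%N -> represents 0 t -> NC_tree R P = t.
Proof.
move=> tn n0 rep.
have [bt _] := dual_tree_spec t.
have tE : (tree_size t <= n.+1)%N by rewrite -size_parents tn.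
have := bt 0%N n rep; rewrite add0n tn => /(_ block_closed0n tE).
rewrite /NC_tree JS_white_contract /dual_tree exploreS => <-; congr (white_contract (Node _)).
(* The first edge in [closing 0 n] leads to the block of label 1, so the rotation at the root is
   trivial. *)
have first_edge : exists c s, closing 0 n = c :: s /\ same (Ordinal n0) c.
  case: t {bt tE} tn rep; elim/last_ind => [|s x _] tn rep.
    by have := n0; rewrite -[X in (_ < X)%N]tn.
  have cn : (0 + size (parents (Node s)) < n)%N.
    by rewrite -tn size_parents_rcons; lia.
  have cE : Ordinal cn = (0 + size (parents (Node s)))%N :> nat by [].
  exists (Ordinal cn), (closing (Ordinal cn).+1 n); split; last first.
    exact: (same_first cE rep).
  have nE : n = ((Ordinal cn).+1 + size (parents x))%N.
    by rewrite -[LHS]tn size_parents_rcons.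
  have := closing_split cE rep; rewrite -nE; apply; exact: block_closed0n.
(* The complement of a union of blocks is one, so [[l + 1, n)] may be replaced by [[0, l + 1)]. *)
have edges : dual_edges P (inr (face n) : dual_vertex R n) = closing 0 n.
  apply: eq_filter => l; rewrite ltn_ord /= faceE; [|by []|exact: ltn_ord|by []].
  by rewrite /label; apply/block_closedP/block_closedP => h i j ij; have := h i j ij;
    have := ltn_ord i; have := ltn_ord j; lia.
have [c [s [cs same0]]] := first_edge.
rewrite /dual_children edges cs /= ifT ?rot0 /= -?map_comp //.
apply/existsP; exists (Ordinal n0); rewrite /label /= andbT.
by rewrite mem_pblock_same.
Qed.

End DualTree.

(** * Chords of the disk *)

Section Plane.
Variable R : realType.
Implicit Types (z : plane R) (t : R).

Definition mix t (z z' : plane R) : plane R :=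
  (t * z.1 + (1 - t) * z'.1, t * z.2 + (1 - t) * z'.2).

Lemma convex_set_mix (A : set (plane R)) :
  (forall t z z', 0 <= t <= 1 -> A z -> A z' -> A (mix t z z')) ->
  @convex_set R (plane R) A.
Proof.
move=> h z z' t; rewrite !inE => Az Az'.
have := h t%:num z z' _ Az Az'; apply.
by rewrite ge0 le1.
Qed.

Lemma convex_hull_mix (S : set (plane R)) t z z' : 0 <= t <= 1 ->
  convex_hull S z -> convex_hull S z' -> convex_hull S (mix t z z').
Proof.
move=> t01 Sz Sz' A [/= Ac SA].
have := Ac z z' (Itv01 (proj1 (andP t01)) (proj2 (andP t01))).
by rewrite !inE; apply; [apply: Sz|apply: Sz'].
Qed.

Lemma unit_disk_mix t z z' : 0 <= t <= 1 ->
  unit_disk z -> unit_disk z' -> unit_disk (mix t z z').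
Proof.
case: z z' => [a b] [c d]; rewrite /unit_disk /mix /= => /andP[t0 t1] h h'.
(* The squared norm of a convex combination falls short of the combination of the squared norms by
   [t * (1 - t)] times the squared distance. *)
have -> : (t * a + (1 - t) * c) ^+ 2 + (t * b + (1 - t) * d) ^+ 2 =
   t * (a ^+ 2 + b ^+ 2) + (1 - t) * (c ^+ 2 + d ^+ 2) -
   t * (1 - t) * ((a - c) ^+ 2 + (b - d) ^+ 2) :> R by ring.
have t'0 : 0 <= 1 - t by rewrite subr_ge0.
have : 0 <= t * (1 - t) * ((a - c) ^+ 2 + (b - d) ^+ 2) :> R.
  by apply: mulr_ge0; [exact: mulr_ge0|apply: addr_ge0; exact: sqr_ge0].
have := ler_wpM2l t0 h; have := ler_wpM2l t'0 h'.
by lra.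
Qed.

Lemma circle_point_in_disk n x : unit_disk (@circle_point R n x).
Proof. by rewrite /unit_disk /= cos2Dsin2. Qed.

(* The affine form vanishing on the line through the points of parameters [x]
   and [y] of the circle; for [x = y] this is the tangent line. *)
Definition chord n (x y : R) z : R :=
  z.1 * cos (pi * (x + y) / n%:R) - z.2 * sin (pi * (x + y) / n%:R)
  - cos (pi * (y - x) / n%:R).

Lemma chord_mix n x y t z z' :
  chord n x y (mix t z z') = t * chord n x y z + (1 - t) * chord n x y z'.
Proof. by case: z z' => [a b] [c d]; rewrite /chord /mix /=; ring. Qed.

(** The sign of the form at a point of the circle is thus read off from two sines, vanishing at
    [u = x] and [u = y]. *)
Lemma chordE n x y u : chord n x y (circle_point n u) =
  - 2 * sin (pi * (u - x) / n%:R) * sin (pi * (u - y) / n%:R).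
Proof.
rewrite /chord /circle_point /= cosN sinN.
set a := pi * (u - x) / n%:R; set b := pi * (u - y) / n%:R.
have -> : pi * (y - x) / n%:R = a - b by rewrite /a /b; ring.
have <- : cos (2 * pi * u / n%:R - pi * (x + y) / n%:R) - cos (a - b) =
    - 2 * sin a * sin b.
  have -> : 2 * pi * u / n%:R - pi * (x + y) / n%:R = a + b.
    by rewrite /a /b; ring.
  by rewrite cosD cosB; ring.
by rewrite (cosB (2 * pi * u / n%:R)); ring.
Qed.

Section Sign.
Variables (n : nat) (n_gt0 : (0 < n)%N).

Let sin_gt0 (t : R) : 0 < t < n%:R -> 0 < sin (pi * t / n%:R).
Proof.
move=> /andP[t0 tn]; have n0 : 0 < n%:R :> R by rewrite ltr0n.
apply: sin_gt0_pi; rewrite !mulr_gt0 ?pi_gt0 ?invr_gt0 //=.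
by rewrite ltr_pdivrMr // ltr_pM2l ?pi_gt0.
Qed.

Let sin_lt0 (t : R) : - n%:R < t < 0 -> sin (pi * t / n%:R) < 0.
Proof.
move=> tn; have : 0 < sin (pi * (- t) / n%:R) by apply: sin_gt0; lra.
by rewrite mulrN mulNr sinN oppr_gt0.
Qed.

Lemma chord_gt0 x y u : x < u < y -> y - x < n%:R ->
  0 < chord n x y (circle_point n u).
Proof.
move=> xuy xy; rewrite chordE -mulrA mulNr oppr_gt0 pmulr_rlt0 //.
by rewrite pmulr_rlt0; [apply: sin_lt0; lra|apply: sin_gt0; lra].
Qed.

Lemma chord_lt0_left x y u : u < x -> u < y -> x - u < n%:R -> y - u < n%:R ->
  chord n x y (circle_point n u) < 0.
Proof.
move=> *; rewrite chordE -mulrA mulNr oppr_lt0 pmulr_rgt0 //.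
by rewrite nmulr_rgt0; apply: sin_lt0; lra.
Qed.

Lemma chord_lt0_right x y u : x < u -> y < u -> u - x < n%:R -> u - y < n%:R ->
  chord n x y (circle_point n u) < 0.
Proof.
move=> *; rewrite chordE -mulrA mulNr oppr_lt0 pmulr_rgt0 //.
by rewrite pmulr_rgt0; apply: sin_gt0; lra.
Qed.

Lemma chord_endl x y : chord n x y (circle_point n x) = 0.
Proof. by rewrite chordE subrr mulr0 mul0r sin0 mulr0 mul0r. Qed.

Lemma chord_endr x y : chord n x y (circle_point n y) = 0.
Proof. by rewrite chordE subrr mulr0 mul0r sin0 mulr0. Qed.

(* In the orthonormal frame whose first axis is the normal of the chord, a point
   of the disk on the line is given by its second coordinate [s], and
   [s ^+ 2 <= sin h ^+ 2], where [sin h] and [- sin h] are those of the ends. *)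
Lemma chord_segment x y z : x < y -> y - x < n%:R -> unit_disk z ->
  chord n x y z = 0 ->
  exists2 t, 0 <= t <= 1 & z = mix t (circle_point n x) (circle_point n y).
Proof.
move=> xy yxn; case: z => [a b]; rewrite /unit_disk /chord /mix /circle_point /=.
set m := pi * (x + y) / n%:R; set h := pi * (y - x) / n%:R.
have -> : - (2 * pi * x / n%:R) = h - m by rewrite /m /h; ring.
have -> : - (2 * pi * y / n%:R) = - (h + m) by rewrite /m /h; ring.
have sh : 0 < sin h by apply: sin_gt0; lra.
rewrite cosN sinN cosB sinB cosD sinD.
have := cos2Dsin2 m; have := cos2Dsin2 h.
move: (cos m) (sin m) (cos h) (sin h) sh => cm sm ch sh sh0 h1 m1 ab1 abE.
have abE' : ch = a * cm - b * sm by lra.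
(* [r] is the second coordinate divided by [sin h]; it lies in [[-1, 1]], and [(r + 1) / 2] is the
   required weight. *)
pose r := (a * sm + b * cm) / sh.
have rE : r * sh = a * sm + b * cm by rewrite /r divfK // gt_eqF.
have ae : a = ch * cm + r * sh * sm.
  by rewrite rE abE' -[LHS]mulr1 -m1; ring.
have be : b = - ch * sm + r * sh * cm.
  by rewrite rE abE' -[LHS]mulr1 -m1; ring.
have r1 : r ^+ 2 <= 1.
  rewrite -(ler_pM2r (exprn_gt0 2 sh0)) mul1r -exprMn rE.
  have : (a * sm + b * cm) ^+ 2 + ch ^+ 2 = (a ^+ 2 + b ^+ 2) * (cm ^+ 2 + sm ^+ 2).
    by rewrite abE'; ring.
  by rewrite m1 mulr1; lra.
exists ((r + 1) / 2); first by nra.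
by congr pair; rewrite ?ae ?be; field.
Qed.

End Sign.

Lemma chord_continuous n x y : continuous (chord n x y).
Proof.
move=> z; apply: cvgB; last exact: cvg_cst.
apply: cvgB; apply: cvgM; try exact: cvg_cst; [exact: cvg_fst|exact: cvg_snd].
Qed.

(** Intermediate value theorem: the image of a connected set under the form is an interval. *)
Lemma chord_crossing n x y (W : set (plane R)) z z' : connected W ->
  W z -> W z' -> chord n x y z < 0 -> 0 < chord n x y z' ->
  exists2 c, W c & chord n x y c = 0.
Proof.
move=> Wc Wz Wz' neg pos.
have /connected_intervalP itv : connected [set chord n x y c | c in W].
  apply: connected_continuous_connected => //.
  by apply: continuous_subspaceT; apply: chord_continuous.
have [|c Wc0 c0] := itv _ _ (imageP _ Wz) (imageP _ Wz') 0; first by rewrite !ltW.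
by exists c.
Qed.

Lemma connected_segment z z' : connected [set mix t z z' | t in `[0, 1]].
Proof.
apply: connected_continuous_connected (@segment_connected R 0 1) _.
apply: continuous_subspaceT => t.
have coord (a b : R) : t' * a + (1 - t') * b @[t' --> t] --> t * a + (1 - t) * b.
  by apply: cvgD; apply: cvgM; rewrite ?cvg_cst //; try apply: cvgB;
    try exact: cvg_cst; exact: cvg_id.
exact: cvg_pair (coord z.1 z'.1) (coord z.2 z'.2).
Qed.

(** * Hulls of blocks and sides of chords *)

Section Hulls.
Variable n : nat.
Implicit Types (B C : {set 'I_n}).

Lemma block_hull_sub B (A : set (plane R)) :
  (forall t z z', 0 <= t <= 1 -> A z -> A z' -> A (mix t z z')) ->
  (forall i, i \in B -> A (circle_point n (label i)%:R)) ->
  block_hull B `<=` A.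
Proof.
move=> Amix AB; apply: smallest_sub; first exact: convex_set_mix.
by move=> _ [i /= iB <-]; apply: AB.
Qed.

Lemma block_hull_point B i : i \in B ->
  block_hull B (circle_point n (label i)%:R : plane R).
Proof. by move=> iB; apply: sub_gen_smallest; exists i. Qed.

Lemma block_hull_disk B : block_hull B `<=` @unit_disk R.
Proof.
apply: block_hull_sub => [t z z'|i _]; first exact: unit_disk_mix.
exact: circle_point_in_disk.
Qed.

Lemma block_hull_gt0 B x y :
  (forall i, i \in B -> 0 < chord n x y (circle_point n (label i)%:R)) ->
  block_hull B `<=` [set z | 0 < chord n x y z].
Proof.
apply: block_hull_sub => t z z' /andP[t0 t1] /= z0 z'0; rewrite chord_mix.
have [->|tneq] := eqVneq t 0; first by rewrite mul0r add0r subr0 mul1r.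
apply: ltr_pwDl; first by rewrite mulr_gt0 // lt_neqAle eq_sym tneq.
by apply: mulr_ge0; [rewrite subr_ge0|apply: ltW].
Qed.

Lemma block_hull_lt0 B x y :
  (forall i, i \in B -> chord n x y (circle_point n (label i)%:R) < 0) ->
  block_hull B `<=` [set z | chord n x y z < 0].
Proof.
apply: block_hull_sub => t z z' /andP[t0 t1] /= z0 z'0; rewrite chord_mix.
have [->|tneq] := eqVneq t 0; first by rewrite mul0r add0r subr0 mul1r.
rewrite -oppr_gt0 opprD -!mulrN; apply: ltr_pwDl.
  by rewrite mulr_gt0 ?oppr_gt0 // lt_neqAle eq_sym tneq.
by apply: mulr_ge0; [rewrite subr_ge0|rewrite oppr_ge0; apply: ltW].
Qed.

(** Within the disk the line reduces to the segment between the points [i] and [j], which lies in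
    the hull by convexity. *)
Lemma chord_in_hull B (i j : 'I_n) z : (i < j)%N -> i \in B -> j \in B ->
  unit_disk z -> chord n (label i)%:R (label j)%:R z = 0 -> block_hull B z.
Proof.
move=> ij iB jB zd z0.
have [|||t t01 ->] := chord_segment _ _ _ zd z0.
- exact: leq_ltn_trans (ltn_ord j).
- by rewrite ltr_nat.
- by rewrite ltrBlDr -natrD ltr_nat /label; have := ltn_ord j; lia.
by apply: convex_hull_mix => //; apply: block_hull_point.
Qed.

End Hulls.

End Plane.

(** Ordinal [i] has label [i.+1], so with [lt_half] the points between the midpoints of arcs [k] and
    [m] are those with [k <= i < m]. *)
Lemma half_lt (R : realType) (k i : nat) :
  (k%:R + 2^-1 < i.+1%:R :> R) = (k <= i)%N.
Proof.
apply/idP/idP => h; last by move: h; rewrite -(ler_nat R) -[i.+1%:R]natr1; lra.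
by rewrite leqNgt; apply/negP; rewrite -(ler_nat R) => h'; lra.
Qed.

Lemma lt_half (R : realType) (k i : nat) :
  (i.+1%:R < k%:R + 2^-1 :> R) = (i < k)%N.
Proof.
apply/idP/idP => h; last by move: h; rewrite -(ler_nat R); lra.
by rewrite ltnNge; apply/negP; rewrite -(ler_nat R) => h'; move: h; rewrite -[i.+1%:R]natr1; lra.
Qed.

Section Mid.
Variables (R : realType) (n : nat).

Local Notation pt i := (circle_point n (label i)%:R : plane R).
Local Notation chord_mid k m := (@chord R n (k%:R + 2^-1) (m%:R + 2^-1)).

Lemma chord_mid_gt0 k m (i : 'I_n) : (0 < k)%N -> (m <= n)%N ->
  (k <= i < m)%N -> 0 < chord_mid k m (pt i).
Proof.
move=> k0 mn /andP[ki im]; apply: chord_gt0; first exact: leq_ltn_trans (ltn_ord i).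
  by rewrite half_lt lt_half ki.
have : m%:R <= n%:R :> R by rewrite ler_nat.
have : 1 <= k%:R :> R by rewrite ler1n.
by lra.
Qed.

(** The case [k = m] is allowed: the line is then the tangent at the midpoint, and every labelled
    point is on its negative side. *)
Lemma chord_mid_lt0 k m (i : 'I_n) : (0 < k)%N -> (k <= m)%N -> (m <= n)%N ->
  ~~ (k <= i < m)%N -> chord_mid k m (pt i) < 0.
Proof.
move=> k0 km mn ikm; have n0 := leq_ltn_trans (leq0n i) (ltn_ord i).
have : m%:R <= n%:R :> R by rewrite ler_nat.
have : k%:R <= m%:R :> R by rewrite ler_nat.
have : 1 <= k%:R :> R by rewrite ler1n.
have : 1 <= (label i)%:R :> R by rewrite ler1n.
have : (label i)%:R <= n%:R :> R by rewrite ler_nat ltn_ord.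
have [ik|ki] := ltnP i k.
  have : (label i)%:R < k%:R + 2^-1 :> R by rewrite lt_half.
  by move=> *; apply: chord_lt0_left => //; lra.
have : m%:R + 2^-1 < (label i)%:R :> R by rewrite half_lt; lia.
by move=> *; apply: chord_lt0_right => //; lra.
Qed.

End Mid.

(** * Equality of faces *)

Section Partition.
Variables (R : realType) (n : nat) (P : {set {set 'I_n}}).
Hypothesis P_part : finset.partition P [set: 'I_n]%SET.

Local Notation face l := (@white_face R n P l).
Local Notation mid k := (circle_point n (k%:R + 2^-1) : plane R).
Local Notation pt i := (circle_point n (label i)%:R : plane R).
Local Notation chord_mid k m := (@chord R n (k%:R + 2^-1) (m%:R + 2^-1)).

Lemma block_same (B : {set 'I_n}) i j : B \in P -> i \in B -> j \in B -> same P i j.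
Proof.
case/and3P: P_part => _ Pt _ BP iB jB.
by rewrite /same !(def_pblock Pt BP).
Qed.

Lemma pblock_in i : finset.pblock P i \in P.
Proof. by case/and3P: P_part => /eqP Pc _ _; rewrite pblock_mem // Pc inE. Qed.

(** The tangent at the midpoint leaves the whole hull strictly on one side. *)
Lemma mid_not_in_hull k (B : {set 'I_n}) : (0 < k <= n)%N -> ~ block_hull B (mid k).
Proof.
case/andP=> k0 kn; have neg j : j \in B -> chord_mid k k (pt j) < 0.
  by move=> jB; apply: chord_mid_lt0 => //; lia.
by move/(block_hull_lt0 neg); rewrite /= chord_endl ltxx.
Qed.

Lemma face_eqE k m : (0 < k)%N -> (k <= m)%N -> (m <= n)%N ->
  `[< face k = face m >] = block_closed P k m.
Proof.
move=> k0 km mn; set D := @unit_disk R `\` \bigcup_(B in [set` P]) block_hull B.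
have Dmid l : (0 < l <= n)%N -> D (mid l).
  by move=> ln; split=> [|[B _]]; [exact: circle_point_in_disk|exact: mid_not_in_hull].
have Dk : D (mid k) by apply: Dmid; lia.
have faceD l : (0 < l <= n)%N -> face l (mid l).
  by move=> ln; apply: connected_component_refl; apply: Dmid.
apply/asboolP/idP => [fkm|cl].
- apply: block_closed_intro => i j ij /andP[ki im]; apply/negPn/negP => kj.
  have iB : i \in finset.pblock P i by rewrite mem_pblock_same // /same.
  have jB : j \in finset.pblock P i by rewrite mem_pblock_same // same_sym.
  have fk : face k (mid k) by apply: faceD; lia.
  have fm : face k (mid m) by rewrite fkm; apply: faceD; lia.
  have fc : connected (face k) by apply: component_connected.
  (* The face avoids the segment joining two points of a block, since this segment is in the
     hull. *)
  have no_zero (i' j' : 'I_n) z : (i' < j')%N -> i' \in finset.pblock P i ->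
      j' \in finset.pblock P i -> face k z ->
      chord n (label i')%:R (label j')%:R z = 0 -> False.
    move=> ij' i'B j'B /connected_component_sub[zd zh] z0.
    by apply: zh; exists (finset.pblock P i); [exact: pblock_in|exact: chord_in_hull z0].
  have n0 : (0 < n)%N by lia.
  have gap (p q : R) : 1 <= p -> q <= n%:R -> q - p < n%:R by lra.
  have gap_half (p q : R) : 1 <= p -> q <= n%:R -> q + 2^-1 - p < n%:R by lra.
  have half_gap (p q : R) : 1 <= p -> q <= n%:R -> q - (p + 2^-1) < n%:R by lra.
  have b1 : 1 <= k%:R :> R by rewrite ler1n.
  have b2 : k%:R <= m%:R :> R by rewrite ler_nat.
  have b3 : m%:R <= n%:R :> R by rewrite ler_nat.
  have b4 : 1 <= (label i)%:R :> R by rewrite ler1n.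
  have b5 : 1 <= (label j)%:R :> R by rewrite ler1n.
  have b6 : (label i)%:R <= n%:R :> R by rewrite ler_nat ltn_ord.
  have b7 : (label j)%:R <= n%:R :> R by rewrite ler_nat ltn_ord.
  have b8 : k%:R + 2^-1 < (label i)%:R :> R by rewrite half_lt.
  have b9 : (label i)%:R < m%:R + 2^-1 :> R by rewrite lt_half.
  (* The chord through [i] and [j] separates the arcs: if [j < k] then arc [k] lies between [j] and
     [i], otherwise arc [m] lies between [i] and [j], and the other arc lies outside. *)
  have [jk|kj'] := ltnP j k.
    have b10 : (label j)%:R < k%:R + 2^-1 :> R by rewrite lt_half.
    have [||z fz z0] := @chord_crossing R n (label j)%:R (label i)%:R _ _ _ fc fm fk.
    - exact: chord_lt0_right (lt_trans b10 (lt_trans b8 b9)) b9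
        (gap_half _ _ b5 b3) (gap_half _ _ b4 b3).
    - by apply: chord_gt0; [|rewrite b10|exact: gap].
    have ji : (j < i)%N := leq_trans jk ki.
    exact: no_zero ji jB iB fz z0.
  have mj : (m <= j)%N by move: kj; rewrite kj' /= -leqNgt.
  have b10 : m%:R + 2^-1 < (label j)%:R :> R by rewrite half_lt.
  have [||z fz z0] := @chord_crossing R n (label i)%:R (label j)%:R _ _ _ fc fk fm.
  - exact: chord_lt0_left b8 (lt_trans (lt_trans b8 b9) b10)
      (half_gap _ _ b1 b6) (half_gap _ _ b1 b7).
  - by apply: chord_gt0; [|rewrite b9|exact: gap].
  have ij' : (i < j)%N := leq_trans im mj.
  exact: no_zero ij' iB jB fz z0.
- apply: same_connected_component.
  apply: (@connected_component_max _ D [set mix t (mid k) (mid m) | t in `[0, 1]]).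
  + exists 1; rewrite /= ?in_itv /= ?lexx ?ler01 //.
    by rewrite /mix subrr !mul1r !mul0r !addr0.
  + move=> _ [t /= t01 <-]; rewrite in_itv /= in t01.
    split; first by apply: unit_disk_mix => //; apply: circle_point_in_disk.
    move=> [B BP]; have z0 : chord_mid k m (mix t (mid k) (mid m)) = 0.
      by rewrite chord_mix chord_endl chord_endr !mulr0 addr0.
    (* As [[k, m)] is a union of blocks, each block is entirely on one side of the chord joining the
       midpoints. *)
    have [/existsP[i /andP[iB ikm]]|none] := boolP [exists i, (i \in B) && (k <= i < m)%N].
      have pos j : j \in B -> 0 < chord_mid k m (pt j).
        move=> jB; apply: chord_mid_gt0 => //.
        by move/block_closedP: cl => /(_ i j (block_same BP iB jB)) <-.
      by move/(block_hull_gt0 pos); rewrite /= z0 ltxx.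
    have neg j : j \in B -> chord_mid k m (pt j) < 0.
      move=> jB; apply: chord_mid_lt0 => //.
      by move: none; rewrite negb_exists => /forallP/(_ j); rewrite jB.
    by move/(block_hull_lt0 neg); rewrite /= z0 ltxx.
  + exact: connected_segment.
  + exists 0; rewrite /= ?in_itv /= ?lexx ?ler01 //.
    by rewrite /mix subr0 !mul1r !mul0r !add0r.
Qed.

End Partition.

(** * The bijection *)

Section Noncrossing.
Variables (R : realType) (n : nat) (P : {set {set 'I_n}}).
Hypothesis P_part : finset.partition P [set: 'I_n]%SET.

(** The line through [j] and [l] separates [i] from [k], so the segment from [i] to [k] meets it at
    a point of the disk, which lies in both hulls; disjointness forces the blocks to coincide. *)
Lemma noncrossing_same (i j k l : 'I_n) : noncrossing R P ->
  (i < j)%N -> (j < k)%N -> (k < l)%N -> same P i k -> same P j l -> same P i j.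
Proof.
move=> nc ij jk kl ik jl; apply/negPn/negP => nij.
have n0 : (0 < n)%N by exact: leq_ltn_trans (ltn_ord i).
pose f := @chord R n (label j)%:R (label l)%:R.
pose pt (i : 'I_n) : plane R := circle_point n (label i)%:R.
have lt_label (p q : 'I_n) : (p < q)%N -> (label p)%:R < (label q)%:R :> R.
  by rewrite ltr_nat.
have gap (p q : 'I_n) : (label q)%:R - (label p)%:R < n%:R :> R.
  by rewrite ltrBlDr -natrD ltr_nat /label; have := ltn_ord q; lia.
have fi : f (pt i) < 0.
  by apply: chord_lt0_left; rewrite ?gap ?lt_label // (ltn_trans ij) // (ltn_trans jk).
have fk : 0 < f (pt k) by apply: chord_gt0; rewrite ?gap ?lt_label.
(* The weight at which the affine form [f] vanishes on the segment. *)
pose t := f (pt k) / (f (pt k) - f (pt i)).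
have d0 : 0 < f (pt k) - f (pt i) by rewrite subr_gt0 (lt_trans fi).
have t01 : 0 <= t <= 1.
  by rewrite divr_ge0 ?(ltW fk) ?(ltW d0) //= ler_pdivrMr // mul1r lerDl oppr_ge0 ltW.
have ft : f (mix t (pt i) (pt k)) = 0.
  rewrite /f chord_mix -/f /t; field; exact: lt0r_neq0.
have hB : block_hull (finset.pblock P i) (mix t (pt i) (pt k)).
  by apply: convex_hull_mix => //; apply: block_hull_point;
    rewrite mem_pblock_same // /same // eq_sym.
have hC : block_hull (finset.pblock P j) (mix t (pt i) (pt k)).
  apply: (@chord_in_hull _ _ _ j l); rewrite ?mem_pblock_same //.
  - exact: ltn_trans kl.
  - exact: eqxx.
  - by rewrite same_sym.
  - exact: block_hull_disk hB.
have := nc _ _ (pblock_in P_part i) (pblock_in P_part j) nij.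
by move/seteqP => [/(_ _ (conj hB hC))].
Qed.

(** Suppose that [B] starts before [C], and let [l] be the last element of [B] preceding [C]. The
    chord from the arc after [l] to the arc after the last element of [C] separates the two
    blocks. *)
Lemma same_noncrossing :
  (forall i j k l : 'I_n, (i < j)%N -> (j < k)%N -> (k < l)%N ->
     same P i k -> same P j l -> same P i j) ->
  noncrossing R P.
Proof.
move=> nc B C BP CP BC.
have [_ Pt P0] := and3P P_part.
have /set0Pn[b bB] : B != finset.set0 by apply: contraNneq P0 => <-.
have /set0Pn[c cC] : C != finset.set0 by apply: contraNneq P0 => <-.
have notsame (i j : 'I_n) : i \in B -> j \in C -> same P i j -> False.
  by rewrite /same => iB jC; rewrite (def_pblock Pt BP iB) (def_pblock Pt CP jC) (negbTE BC).
pose i0 := [arg min_(i < b in B) (i : nat)]; pose j0 := [arg min_(i < c in C) (i : nat)].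
have [i0B i0min] : i0 \in B /\ forall i, i \in B -> (i0 <= i)%N.
  by rewrite /i0; case: arg_minnP => // i iB im; split.
have [j0C j0min] : j0 \in C /\ forall i, i \in C -> (j0 <= i)%N.
  by rewrite /j0; case: arg_minnP => // i iC im; split.
move: i0 j0 i0B i0min j0C j0min => {b c bB cC} i0 j0.
wlog ij : B C BP CP BC notsame i0 j0 / (i0 < j0)%N => [main|] i0B i0min j0C j0min.
  case: (ltngtP i0 j0) => [ij|ji|/val_inj E].
  - exact: main ij i0B i0min j0C j0min.
  - rewrite setIC; apply: main ji j0C j0min i0B i0min => //; first by rewrite eq_sym.
    by move=> i j iC jB; rewrite same_sym; apply: notsame.
  - by case: (notsame i0 j0 i0B j0C); rewrite E /same.
have [l lB [lj lmax]] : exists2 l, l \in B & (l < j0)%N /\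
    forall i, i \in B -> (i < j0)%N -> (i <= l)%N.
  case: (arg_maxnP (P := fun i : 'I_n => (i \in B) && (i < j0)%N) (fun i : 'I_n => i : nat)
    (i0 := i0)) => [|l /andP[lB lj] lm]; first by rewrite i0B.
  by exists l => //; split => // i iB ij0; apply: lm; rewrite iB.
have [m mC mmax] : exists2 m, m \in C & forall i, i \in C -> (i <= m)%N.
  by case: (arg_maxnP (P := mem C) (fun i : 'I_n => i : nat) j0C) => m mC mm; exists m.
have jm := j0min _ mC.
have pos i : i \in C ->
    0 < @chord R n (l.+1%:R + 2^-1) (m.+1%:R + 2^-1) (circle_point n (label i)%:R).
  move=> iC; apply: chord_mid_gt0 => //.
  by rewrite ltnS mmax // andbT (leq_trans lj) // j0min.
have neg i : i \in B ->
    @chord R n (l.+1%:R + 2^-1) (m.+1%:R + 2^-1) (circle_point n (label i)%:R) < 0.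
  move=> iB; have lm : (l <= m)%N := ltnW (leq_trans lj jm).
  apply: chord_mid_lt0 => //.
  (* Such an [i] would give [l < j0 < i < m] with [l], [i] in [B] and [j0], [m] in [C]: a
     crossing. *)
  apply/negP => /andP[li]; rewrite ltnS => im.
  have ji : (j0 < i)%N.
    case: (ltngtP i j0) => [ij0||/val_inj E] //; first by have := lmax _ iB ij0; lia.
    by case: (notsame i j0 iB j0C); rewrite E /same.
  have im' : (i < m)%N.
    case: (ltngtP i m) im => // /val_inj E _.
    by case: (notsame i m iB mC); rewrite E /same.
  apply: (notsame l j0 lB j0C); apply: nc lj ji im' _ _.
    exact: (block_same P_part BP).
  exact: (block_same P_part CP).
rewrite -subset0 => z [/(block_hull_lt0 neg) /= z0 /(block_hull_gt0 pos) /= /(lt_trans z0)].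
by rewrite ltxx.
Qed.

Lemma noncrossing_represented : noncrossing R P ->
  exists2 t, size (parents t) = n & represents P 0 t.
Proof.
(* [f] extends the block map to all naturals, with value [None] outside the range, as
   [noncrossing_parent_of] asks for a relation on naturals. *)
move=> nc; pose f (i : nat) := omap (finset.pblock P) (insub i : option 'I_n).
have fE (i : 'I_n) : f i = Some (finset.pblock P i) by rewrite /f valK.
have [||||t tn tE] := @noncrossing_parent_of (fun i j => f i == f j) 0 n.
- by move=> i; apply: eqxx.
- by move=> i j; apply: eq_sym.
- by move=> j i k /eqP ->.
- move=> i j k l /andP[_ ij] /andP[jk kl] ln.
  have kn := ltn_trans kl ln; have jn := ltn_trans jk kn; have i_n := ltn_trans ij jn.
  rewrite (fE (Ordinal ln)) (fE (Ordinal kn)) (fE (Ordinal jn)) (fE (Ordinal i_n)).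
  by move=> ik jl; apply: (noncrossing_same nc (k := Ordinal kn) (l := Ordinal ln)).
exists t => //; split; first by rewrite add0n tn.
move=> i j _ _; rewrite !subn0 -tE ?ltn_ord // !add0n !fE //.
Qed.

(** The blocks are the nonempty fibers of [parent_of]; vertices with an empty fiber are leaves, of
    weight [w 0 = 1]. *)
Lemma block_weight_represented (w : nat -> R) t : w 0%N = 1 ->
  size (parents t) = n -> represents P 0 t -> block_weight w P = tree_weight w t.
Proof.
move=> w0 tn [_ tE].
have sameE i j : same P i j = (parent_of t i == parent_of t j).
  by rewrite tE ?subn0 // add0n tn ltn_ord.
pose fiber (v : 'I_n.+1) := [set i : 'I_n | parent_of t i == v]%SET.
have fiberE (i : 'I_n) v : i \in fiber v -> fiber v = finset.pblock P i.
  rewrite inE => /eqP iv; apply/setP => j.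
  by rewrite inE mem_pblock_same // sameE iv.
have le_n (i : 'I_n) : (parent_of t i < n.+1)%N.
  by rewrite ltnS (leq_trans (parent_of_le _ _)) // ltnW.
have PE : P = (fiber @: [set v | fiber v != finset.set0])%SET.
  apply/setP => B; apply/idP/imsetP => [BP|[v]].
    have [_ Pt P0] := and3P P_part.
    have /set0Pn[i iB] : B != finset.set0 by apply: contraNneq P0 => <-.
    have iv : i \in fiber (Ordinal (le_n i)) by rewrite inE.
    exists (Ordinal (le_n i)); first by rewrite inE; apply/set0Pn; exists i.
    by rewrite (fiberE _ _ iv) (def_pblock Pt BP iB).
  by rewrite inE => /set0Pn[i iv] ->; rewrite (fiberE _ _ iv) pblock_in.
rewrite /block_weight PE big_imset => [|u v] /=; last first.
  rewrite inE => /set0Pn[i iu] _ uv; apply/val_inj.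
  have iv : i \in fiber v by rewrite -uv.
  by move: iu iv; rewrite !inE => /eqP ui /eqP vi; apply: etrans (esym ui) vi.
rewrite tree_weight_parents -size_parents tn big_mkord.
rewrite [RHS](bigID (fun v => fiber v != finset.set0)) /=.
have countE (v : 'I_n.+1) : count_mem (v : nat) (parents t) = #|fiber v|.
  have -> : parents t = [seq parent_of t i | i : 'I_n <- enum 'I_n].
    rewrite (map_comp (parent_of t) val) val_enum_ord -tn.
    by rewrite -[LHS](mkseq_nth 0%N).
  rewrite count_map -sum1_count -sum1_card big_enum_cond /=.
  by apply: eq_bigl => i; rewrite inE.
rewrite [X in _ * X]big1 => [|v]; last first.
  by rewrite negbK countE => /eqP ->; rewrite cards0.
by rewrite mulr1; apply: eq_big => v; rewrite ?inE // => _; rewrite countE.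
Qed.

End Noncrossing.

(** * From trees back to partitions *)

Section Inverse.
Variables (R : realType) (n : nat) (t : plane_tree).
Hypothesis tn : size (parents t) = n.

Definition sibling_partition : {set {set 'I_n}} :=
  preim_partition (fun i : 'I_n => parent_of t i) [set: 'I_n]%SET.

Lemma sibling_partition_part : finset.partition sibling_partition [set: 'I_n]%SET.
Proof. exact: preim_partitionP. Qed.

Lemma same_sibling_partition i j :
  same sibling_partition i j = (parent_of t i == parent_of t j).
Proof.
rewrite -mem_pblock_same ?sibling_partition_part // eq_sym.
rewrite pblock_equivalence_partition ?inE //.
by move=> a b c _ _ _ /=; split=> // /eqP ->.
Qed.

Lemma represents_sibling_partition : represents sibling_partition 0 t.
Proof.
split; first by rewrite add0n tn.
by move=> i j _ _; rewrite !subn0 same_sibling_partition.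
Qed.

(** Applied to [i < j < k] and to [j < k < l], [parent_of_between] gives both inequalities between
    the two parents. *)
Lemma sibling_partition_NC : sibling_partition \in NC R n.
Proof.
rewrite inE sibling_partition_part; apply/asboolP/same_noncrossing.
  exact: sibling_partition_part.
move=> i j k l ij jk kl; rewrite !same_sibling_partition => /eqP ik /eqP jl.
have ln : (l < size (parents t))%N by rewrite tn.
rewrite eqn_leq (parent_of_between ij jk _ ik) ?(ltn_trans kl) //=.
by rewrite ik; apply: parent_of_between jk kl ln jl.
Qed.

End Inverse.

Lemma represents_inj n (P Q : {set {set 'I_n}}) t :
  finset.partition P [set: 'I_n]%SET -> finset.partition Q [set: 'I_n]%SET ->
  size (parents t) = n -> represents P 0 t -> represents Q 0 t -> P = Q.
Proof.
move=> Pp Qp tn [_ PE] [_ QE].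
have [/eqP Pc Pt _] := and3P Pp; have [/eqP Qc Qt _] := and3P Qp.
suff E i : finset.pblock P i = finset.pblock Q i.
  have sub (A B : {set {set 'I_n}}) : finset.partition A [set: 'I_n]%SET ->
      finset.partition B [set: 'I_n]%SET ->
      (forall i, finset.pblock A i = finset.pblock B i) -> A \subset B.
    move=> Ap Bp AB; apply/fintype.subsetP => C CA; have [_ At A0] := and3P Ap.
    have /set0Pn[i iC] : C != finset.set0 by apply: contraNneq A0 => <-.
    by rewrite -(def_pblock At CA iC) AB pblock_in.
  by apply/eqP; rewrite finset.eqEsubset !sub.
apply/setP => j; rewrite !mem_pblock_same //.
by rewrite PE ?QE // add0n tn ltn_ord.
Qed.

Theorem proposition6 (R : realType) (w : nat -> R)
    (w0 : w 0%N = 1) (w_ge0 : forall i : nat, (1 <= i)%N -> 0 <= w i)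
    (n : nat) (n_ge1 : (1 <= n)%N)
    (Z_gt0 : 0 < \sum_(Q in NC R n) block_weight w Q)
    (P : {set {set 'I_n}}) (P_NC : P \in NC R n) :
  [/\ trees n.+1 (NC_tree R P),
      0 < tree_partition_function w n.+1
    & NC_prob w P = tree_prob w n.+1 (NC_tree R P)].
Proof.
have treesE t : trees n.+1 t <-> size (parents t) = n.
  by rewrite /trees /= size_vertices -size_parents; split=> [[]|->].
have NC_part Q : Q \in NC R n -> finset.partition Q [set: 'I_n]%SET.
  by rewrite inE => /andP[].
have treeE Q t : Q \in NC R n -> size (parents t) = n -> represents Q 0 t ->
    NC_tree R Q = t.
  move=> QN tn; apply: NC_tree_represented => //; first exact: NC_part.
  by apply: face_eqE; apply: NC_part.
have rep Q : Q \in NC R n ->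
    size (parents (NC_tree R Q)) = n /\ represents Q 0 (NC_tree R Q).
  move=> QN; have [|t tn Qt] := @noncrossing_represented R n Q (NC_part _ QN).
    by move: QN; rewrite inE => /andP[_ /asboolP].
  by rewrite (treeE _ _ QN tn Qt).
have weightE Q : Q \in NC R n -> block_weight w Q = tree_weight w (NC_tree R Q).
  by move=> QN; have [tn Qt] := rep _ QN; apply: block_weight_represented => //; apply: NC_part.
(* Injectivity: a tree determines the partition it represents. Surjectivity: a tree is the image of
   its sibling partition. *)
have bij : set_bij [set` NC R n] (trees n.+1) (@NC_tree R n).
  split=> [Q /= QN|Q Q' /=|t /treesE tn].
  - by apply/treesE; have [] := rep _ QN.
  - rewrite !inE /= => QN Q'N QQ'; have [tn Qt] := rep _ QN; have [_ Q't] := rep _ Q'N.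
    by apply: represents_inj tn Qt _; rewrite ?QQ' //; apply: NC_part.
  - exists (sibling_partition n t); first exact: sibling_partition_NC.
    by apply: treeE => //; [exact: sibling_partition_NC|exact: represents_sibling_partition].
have ZE : tree_partition_function w n.+1 = \sum_(Q in NC R n) block_weight w Q.
  rewrite /tree_partition_function (reindex_fsbig _ _ _ _ bij).
  rewrite (eq_bigr _ weightE); apply/esym/bigfs; first exact: index_enum_uniq.
  by move=> Q _; rewrite mem_index_enum.
split.
- by apply/treesE; have [] := rep _ P_NC.
- by rewrite ZE.
- by rewrite /NC_prob /tree_prob ZE weightE.
Qed.
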